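(* Assume the 3D pendulum has a single axis of symmetry and the pivot and the center of mass are located on the axis of symmetry, with body-fixed axes chosen so that $J=\mathrm{diag}(J_t,J_t,J_a)$ and $\rho=\rho_s e_3$ with $\rho_s>0$. Then the equations of motion of the 3D pendulum $$J\dot\omega=J\omega\times\omega+mg\,\rho\times\Gamma,\qquad \dot\Gamma=\Gamma\times\omega$$ on $S^2\times\mathbb{R}^3$ define an induced flow on the tangent bundle $TS^1$ corresponding to $\omega_x=0$, $\omega_z=0$ and $\Gamma_y=0$, where $\Gamma=[-\sin\theta\ \ 0\ \ \cos\theta]^T$, given by $$J_t\dot\omega_y=-mg\rho_s\sin\theta,\qquad \dot\theta=\omega_y.$$
   Context: $\Gamma=(\Gamma_x,\Gamma_y,\Gamma_z)=R^Te_3\in S^2$ is the gravity direction in the body-fixed frame ($R\in SO(3)$ the attitude of the rigid body, $e_3=(0,0,1)^T$), $\omega=(\omega_x,\omega_y,\omega_z)\in\mathbb{R}^3$ is the body-fixed angular velocity, $J$ is the inertia matrix (body frame, origin at the pivot; $J_t,J_a>0$), $m>0$ the mass, $g>0$ the gravitational acceleration, $\rho$ the body-fixed vector from the pivot to the center of mass. ''Induced flow'' means that the set $\{(\Gamma,\omega):\omega_x=\omega_z=0,\ \Gamma_y=0\}\cong TS^1$, with coordinates $(\theta,\omega_y)$, is invariant under the dynamics and the restricted dynamics are the displayed equations (those of a 1D planar pendulum). *)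

(* Defs.v *)
From HB Require Import structures.
From mathcomp Require Import all_boot all_order all_algebra.
From mathcomp Require Import all_classical all_reals all_analysis.
Set Implicit Arguments.
Unset Strict Implicit.
Unset Printing Implicit Defensive.
Import Order.TTheory GRing.Theory Num.Theory.
Import numFieldNormedType.Exports.
Local Open Scope ring_scope.
Local Open Scope classical_set_scope.

(* Indices 0, 1, 2 : 'I_3 are the x, y, z components. *)
Definition vec3 (R : realType) (x y z : R) : 'cV[R]_3 :=
  \col_(i < 3) [:: x; y; z]`_i.

Definition crossv (R : realType) (u v : 'cV[R]_3) : 'cV[R]_3 :=
  vec3 (u 1 0 * v 2 0 - u 2 0 * v 1 0)
       (u 2 0 * v 0 0 - u 0 0 * v 2 0)
       (u 0 0 * v 1 0 - u 1 0 * v 0 0).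

(* The Euclidean unit sphere; the library norm on matrices is the sup norm. *)
Definition sphere2 (R : realType) : set 'cV[R]_3 :=
  [set u | \sum_(i < 3) u i 0 ^+ 2 = 1].

Definition open_interval (R : realType) (I : set R) : Prop :=
  open I /\ is_interval I.

(* The curve (Gamma, omega) solves the equations of motion of the 3D pendulum
   on S^2 x R^3 over the open time interval I. *)
Definition pendulum3D_solution (R : realType) (J : 'M[R]_3) (m g : R)
    (rho : 'cV[R]_3) (I : set R) (Gamma omega : R -> 'cV[R]_3) : Prop :=
  forall t, I t ->
    [/\ sphere2 (Gamma t),
        derivable omega t 1,
        J *m derive1 omega t
          = crossv (J *m omega t) (omega t) + (m * g) *: crossv rho (Gamma t),
        derivable Gamma t 1 &
        derive1 Gamma t = crossv (Gamma t) (omega t)].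

Definition planar_pendulum_solution (R : realType) (Jt m g rhos : R)
    (I : set R) (theta omegay : R -> R) : Prop :=
  forall t, I t ->
    [/\ derivable omegay t 1,
        Jt * derive1 omegay t = - (m * g * rhos * sin (theta t)),
        derivable theta t 1 &
        derive1 theta t = omegay t].

(* The copy of TS^1 in S^2 x R^3. *)
Definition planar_set (R : realType) : set ('cV[R]_3 * 'cV[R]_3) :=
  [set x : 'cV[R]_3 * 'cV[R]_3 |
    [/\ sphere2 x.1, x.2 0 0 = 0, x.2 2 0 = 0 & x.1 1 0 = 0]].
Arguments planar_set R _ : clear implicits.

Definition planar_Gamma (R : realType) (theta : R) : 'cV[R]_3 :=
  vec3 (- sin theta) 0 (cos theta).

Definition planar_omega (R : realType) (omegay : R) : 'cV[R]_3 :=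
  vec3 0 omegay 0.

(* Main.v *)
(* In coordinates omega_z is constant, and once it vanishes the pair
   (omega_x, Gamma_y) solves a linear homogeneous system whose coefficients are
   bounded on the sphere, so Gronwall's inequality applied to
   omega_x^2 + Gamma_y^2 shows that the planar set is invariant. The planar
   vector field is globally Lipschitz, hence has a global flow. A planar motion
   of the body is lifted to the angle by comparing it, again with Gronwall, to
   the image of the planar flow line with the same initial condition. *)
Require Import Defs.
From HB Require Import structures.
From mathcomp Require Import all_boot all_order all_algebra.
From mathcomp Require Import all_classical all_reals all_analysis.
From mathcomp Require Import ring lra.
Set Implicit Arguments.
Unset Strict Implicit.
Unset Printing Implicit Defensive.
Import Order.TTheory GRing.Theory Num.Theory.
Import numFieldNormedType.Exports.
Local Open Scope ring_scope.
Local Open Scope classical_set_scope.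

(* As an instance, the chain rule also matches sums and products, seen as
   compositions, and derails the inference of their derivatives. *)
#[local] Remove Hints is_derive1_comp : typeclass_instances.

(** * Monotonicity, Gronwall's inequality and convexity *)

Lemma ge0_is_derive_nondecreasing (R : realType) (I : set R) (f df : R -> R) :
  is_interval I -> (forall t, I t -> is_derive t 1 f (df t)) ->
  (forall t, I t -> 0 <= df t) ->
  forall x y, I x -> I y -> x <= y -> f x <= f y.
Proof.
move=> itvI fdf df_ge0 x y Ix Iy xy.
have Ixy z : z \in `[x, y]%R -> I z.
  by rewrite in_itv/= => ?; exact: (itvI x y).
have [||c /Ixy/df_ge0 dfc_ge0 fyx] := @MVT_segment _ f df x y xy.
- by move=> z /subset_itv_oo_cc/Ixy/fdf.
- apply: derivable_within_continuous => z /Ixy/fdf fz.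
  exact: ex_derive.
- by rewrite -subr_ge0 fyx mulr_ge0// subr_ge0.
Qed.

(** The bound on [dE] makes [E t * expR (- C * t)] nonincreasing and [E t * expR (C * t)]
    nondecreasing. The first carries the zero forward from [t0], the second backward. *)
Lemma gronwall_eq0 (R : realType) (I : set R) (E dE : R -> R) (C t0 : R) :
  is_interval I -> (forall t, I t -> is_derive t 1 E (dE t)) ->
  (forall t, I t -> 0 <= E t) -> (forall t, I t -> `|dE t| <= C * E t) ->
  I t0 -> E t0 = 0 -> forall t, I t -> E t = 0.
Proof.
move=> itvI EdE E_ge0 dE_le It0 Et0 t It.
apply/eqP; rewrite eq_le E_ge0// andbT.
have dexp (k s : R) : is_derive s 1 (fun s => expR (k * s)) (expR (k * s) * k).
  have -> : (fun s => expR (k * s)) = expR \o (k \*: @id R) by [].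
  apply: is_derive1_comp.
  by apply: is_derive_eq; rewrite /GRing.scale/= mulr1.
have [t0t|/ltW tt0] := leP t0 t.
- suff : - E t0 * expR (- C * t0) <= - E t * expR (- C * t).
    by rewrite Et0 oppr0 mul0r mulNr oppr_ge0 pmulr_lle0// expR_gt0.
  apply: (@ge0_is_derive_nondecreasing _ I (fun s => - E s * expR (- C * s))
    (fun s => (C * E s - dE s) * expR (- C * s)) itvI) => // s Is.
    have := EdE s Is => ?; have := dexp (- C) s => ?.
    apply: is_derive_eq; rewrite /GRing.scale/=; ring.
  rewrite mulr_ge0 ?expR_ge0// subr_ge0.
  exact: le_trans (ler_norm _) (dE_le _ Is).
- suff : E t * expR (C * t) <= E t0 * expR (C * t0).
    by rewrite Et0 mul0r pmulr_lle0// expR_gt0.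
  apply: (@ge0_is_derive_nondecreasing _ I (fun s => E s * expR (C * s))
    (fun s => (C * E s + dE s) * expR (C * s)) itvI) => // s Is.
    have := EdE s Is => ?; have := dexp C s => ?.
    apply: is_derive_eq; rewrite /GRing.scale/=; ring.
  rewrite mulr_ge0 ?expR_ge0// addrC -lerBlDr sub0r.
  by have := dE_le _ Is; rewrite ler_norml => /andP[].
Qed.

(** Serves as a comparison principle on the whole line: an inequality between second derivatives
    passes to the functions once values and slopes are compared at [t0]. *)
Lemma convex_ge_critical (R : realType) (h dh ddh : R -> R) (t0 : R) :
  (forall t : R, is_derive t 1 h (dh t)) ->
  (forall t : R, is_derive t 1 dh (ddh t)) ->
  (forall t : R, 0 <= ddh t) -> dh t0 = 0 -> forall t, h t0 <= h t.
Proof.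
move=> hdh dhddh ddh_ge0 dht0 t.
have dh_mono x y : x <= y -> dh x <= dh y.
  by apply: (@ge0_is_derive_nondecreasing _ setT dh ddh).
have [t0t|/ltW tt0] := leP t0 t.
- apply: (@ge0_is_derive_nondecreasing _ `[t0, +oo[ h dh) => //.
  + exact: interval_is_interval.
  + by move=> s /=; rewrite in_itv/= andbT -dht0 => /dh_mono.
  + by rewrite /= in_itv/= lexx.
  + by rewrite /= in_itv/= t0t.
- rewrite -lerN2.
  apply: (@ge0_is_derive_nondecreasing _ `]-oo, t0] (- h) (fun s => - dh s)) => //.
  + exact: interval_is_interval.
  + by move=> s /=; rewrite in_itv/= => /dh_mono; rewrite dht0 oppr_ge0.
  + by rewrite /= in_itv/= lexx.
Qed.

(** * Antiderivatives and global solutions of second-order equations *)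

Lemma exists_antiderivative (R : realType) (f : R -> R) (t0 : R) :
  continuous f ->
  exists F : R -> R, F t0 = 0 /\ forall t : R, is_derive t 1 F (f t).
Proof.
move=> cf.
(* The integral from [- n] is an antiderivative only to the right of [- n]. One is taken for each
   [n], normalised at 0, and they are glued. *)
pose G (n : nat) (t : R) := (\int[lebesgue_measure]_(s in `[- n%:R, t]) f s)%R.
have dG n (t : R) : - n%:R < t -> is_derive t 1 (G n) (f t).
  move=> nt.
  have [||||dGt <-] := @continuous_FTC1_closed R f (- n%:R) t (t + 1).
  - by rewrite ltrDl.
  - apply: continuous_compact_integrable; first exact: segment_compact.
    by apply: continuous_subspaceT => x; exact: cf.
  - exact: nt.
  - exact: cf.
  - by rewrite derive1E; exact: derivableP.
pose H n t := G n t - G n 0.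
have dH n (t : R) : - n%:R < t -> is_derive t 1 (H n) (f t).
  move=> /dG Gt; have -> : H n = G n \- cst (G n 0) by [].
  by apply: is_derive_eq; rewrite subr0.
(* The squared difference has zero derivative, so Gronwall applies with constant 0. The successors
   put 0, where both functions vanish, strictly inside the common domain. *)
have Heq n m (t : R) : - n.+1%:R < t -> - m.+1%:R < t -> H n.+1 t = H m.+1 t.
  move=> nt mt; apply/eqP; rewrite -subr_eq0 -sqrf_eq0.
  pose a : R := Num.max (- n.+1%:R) (- m.+1%:R).
  have aE (s : R) : `]a, +oo[ s -> - n.+1%:R < s /\ - m.+1%:R < s.
    by rewrite /= in_itv/= andbT gt_max => /andP[].
  apply/eqP; apply: (@gronwall_eq0 _ `]a, +oo[
    (fun t => (H n.+1 t - H m.+1 t) ^+ 2) (fun=> 0) 0 0).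
  - exact: interval_is_interval.
  - move=> s /aE[ns ms]; have ? := dH _ _ ns; have ? := dH _ _ ms.
    by apply: is_derive_eq; rewrite subrr scaler0 addr0.
  - by move=> s _; exact: sqr_ge0.
  - by move=> s _; rewrite normr0 mul0r.
  - by rewrite /= in_itv/= andbT gt_max !oppr_lt0 !ltr0Sn.
  - by rewrite /H !subrr expr0n.
  - by rewrite /= in_itv/= andbT gt_max nt mt.
pose N (t : R) := (Num.trunc `|t|).
have ltN (t : R) : - (N t).+1%:R < t.
  by have := truncnS_gt `|t|; rewrite ltr_norml => /andP[].
pose F t := H (N t).+1 t.
(* The index [N] varies with the point, but near [t] the fixed branch [H (N t).+1] takes the same
   values as [F]. *)
have dF (t : R) : is_derive t 1 F (f t).
  have := dH _ _ (ltN t); apply: near_eq_is_derive.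
  near=> s; apply: Heq => //.
  by near: s; exact: lt_nbhsr.
exists (F \- cst (F t0)); split; first by rewrite /= subrr.
by move=> t; apply: is_derive_eq; rewrite subr0.
Unshelve. all: by end_near. Qed.

Lemma exists_geometric_lt (R : realType) (C e : R) :
  0 < e -> exists n : nat, C * 2^-1 ^+ n < e.
Proof.
move=> e0; pose n := Num.trunc (`|C| / e); exists n.
rewrite exprVn ltr_pdivrMr ?exprn_gt0// (le_lt_trans (ler_norm C))//.
rewrite mulrC -ltr_pdivrMr// (lt_le_trans (truncnS_gt _))//.
by rewrite -natrX ler_nat ltn_expl.
Qed.

Lemma lipschitz_continuous (R : realType) (f : R -> R) (L : R) :
  (forall x y, `|f x - f y| <= L * `|x - y|) -> continuous f.
Proof.
move=> fL x; apply/cvgrPdist_lt => /= e e0.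
have L1_gt0 : 0 < `|L| + 1 by rewrite ltr_wpDl.
near=> y.
rewrite (le_lt_trans (fL _ _))// (@le_lt_trans _ _ ((`|L| + 1) * `|x - y|))//.
  by rewrite ler_wpM2r// (le_trans (ler_norm L))// lerDl.
rewrite mulrC -ltr_pdivlMr//.
by near: y; apply: cvgr_dist_lt => //; exact: divr_gt0.
Unshelve. all: by end_near. Qed.

Lemma continuous_of_is_derive (R : realType) (f df : R -> R) :
  (forall t : R, is_derive t 1 f (df t)) -> continuous f.
Proof.
move=> fdf t; apply/differentiable_continuous/derivable1_diffP.
by have := fdf t => ?; exact: ex_derive.
Qed.

(* Picard iteration in Bielecki's weighted norm: the solution operator of
   y'' = f o u contracts by 1/2 in the sup norm with weight 1 / cosh, which
   makes the iteration converge on the whole line at once. *)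
Lemma exists_second_order_solution (R : realType) (f : R -> R)
    (L B t0 a b : R) :
  (forall x y, `|f x - f y| <= L * `|x - y|) -> (forall x, `|f x| <= B) ->
  exists y z : R -> R,
    [/\ y t0 = a, z t0 = b, forall t : R, is_derive t 1 y (z t) &
        forall t : R, is_derive t 1 z (f (y t))].
Proof.
move=> fL fB; have cf := lipschitz_continuous fL.
have L_ge0 : 0 <= L.
  by have := fL 1 0; rewrite subr0 normr1 mulr1; exact: le_trans.
have B_ge0 : 0 <= B by exact: le_trans (fB 0).
(* [pr] is integration from [t0], made total by the junk value 0 on discontinuous functions. *)
have /choice[pr prP] (g : R -> R) : exists F : R -> R, continuous g ->
    F t0 = 0 /\ forall t : R, is_derive t 1 F (g t).
  have [cg|ncg] := pselect (continuous g); last by exists 0.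
  by have [F FP] := exists_antiderivative t0 cg; exists F.
(* [V u] is the velocity and [T u] the position after one Picard step, so a continuous fixed point
   of [T] is a solution. *)
pose V u t := b + pr (f \o u) t.
pose T u t := a + pr (V u) t.
have dV u : continuous u ->
    V u t0 = b /\ forall t : R, is_derive t 1 (V u) (f (u t)).
  move=> cu; have cfu : continuous (f \o u).
    by move=> t; apply: continuous_comp; [exact: cu|exact: cf].
  have [pr0 dpr] := prP _ cfu; split; first by rewrite /V pr0 addr0.
  by move=> t; have := dpr t => ?; apply: is_derive_eq; rewrite add0r.
have dT u : continuous u ->
    T u t0 = a /\ forall t : R, is_derive t 1 (T u) (V u t).
  move=> cu; have [_ /continuous_of_is_derive cV] := dV _ cu.
  have [pr0 dpr] := prP _ cV; split; first by rewrite /T pr0 addr0.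
  by move=> t; have := dpr t => ?; apply: is_derive_eq; rewrite add0r.
(* This rate gives both [2 * L <= la ^+ 2], for the contraction factor 1/2, and [1 <= la ^+ 2], for
   the first step. The weight [w] is twice the hyperbolic cosine of [la * (t - t0)], so its second
   derivative is [la ^+ 2 * w] and it is critical at [t0]. *)
pose la := 1 + L.
pose w t := expR (la * (t - t0)) + expR (- la * (t - t0)).
pose dw t := la * expR (la * (t - t0)) - la * expR (- la * (t - t0)).
have dexp (k s : R) : is_derive s 1 (fun s => expR (k * (s - t0)))
    (k * expR (k * (s - t0))).
  have -> : (fun s => expR (k * (s - t0))) = expR \o (fun s => k * (s - t0)).
    by [].
  rewrite mulrC; apply: is_derive1_comp.
  by apply: is_derive_eq; rewrite subr0 /GRing.scale/= mulr1.
have w_dw (t : R) : is_derive t 1 w (dw t).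
  by apply: is_derive_eq; rewrite mulNr.
have dw_ddw (t : R) : is_derive t 1 dw (la ^+ 2 * w t).
  by apply: is_derive_eq; rewrite /GRing.scale/= /w; ring.
have dw0 : dw t0 = 0 by rewrite /dw subrr !mulr0 subrr.
have w_gt0 t : 0 < w t by rewrite addr_gt0// expR_gt0.
have w_ge0 t : 0 <= w t by exact: ltW.
have la_gt0 : 0 < la by rewrite ltr_pwDl.
have w_ge1 t : 1 <= w t.
  have : w t0 <= w t.
    apply: (convex_ge_critical w_dw dw_ddw) dw0 _ => s.
    by rewrite mulr_ge0 ?sqr_ge0// ltW.
  rewrite /w subrr !mulr0 expR0; lra.
clearbody V T w dw.
(* Both [M * w + (T u - T v)] and [M * w - (T u - T v)] are convex and critical at [t0], where they
   equal [M * w t0]; hence they are nonnegative. *)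
have T_compare u v M : continuous u -> continuous v -> 0 <= M ->
    (forall t, `|f (u t) - f (v t)| <= M * (la ^+ 2 * w t)) ->
    forall t, `|T u t - T v t| <= M * w t.
  move=> cu cv M_ge0 uv t.
  have [Vu0 dVu] := dV _ cu; have [Vv0 dVv] := dV _ cv.
  have [Tu0 dTu] := dT _ cu; have [Tv0 dTv] := dT _ cv.
  rewrite ler_norml lerNl; apply/andP; split.
  - suff : 0 <= M * w t + (T u t - T v t) by lra.
    apply: le_trans (@convex_ge_critical _
      (fun t => M * w t + (T u t - T v t))
      (fun t => M * dw t + (V u t - V v t))
      (fun t => M * (la ^+ 2 * w t) + (f (u t) - f (v t))) t0 _ _ _ _ _).
    + by rewrite Tu0 Tv0 subrr addr0 mulr_ge0// // ltW.
    + move=> s; have := uv s; rewrite ler_norml => /andP[+ _].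
      by lra.
    + by rewrite dw0 Vu0 Vv0 subrr mulr0 addr0.
  - suff : 0 <= M * w t - (T u t - T v t) by lra.
    apply: le_trans (@convex_ge_critical _
      (fun t => M * w t - (T u t - T v t))
      (fun t => M * dw t - (V u t - V v t))
      (fun t => M * (la ^+ 2 * w t) - (f (u t) - f (v t))) t0 _ _ _ _ _).
    + by rewrite Tu0 Tv0 subrr subr0 mulr_ge0// // ltW.
    + move=> s; have := uv s; rewrite ler_norml => /andP[_].
      by lra.
    + by rewrite dw0 Vu0 Vv0 subrr mulr0 subr0.
have T_half u v M : continuous u -> continuous v -> 0 <= M ->
    (forall t, `|u t - v t| <= M * w t) ->
    forall t, `|T u t - T v t| <= M / 2 * w t.
  move=> cu cv M_ge0 uv; apply: T_compare => //; first exact: divr_ge0.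
  move=> t; rewrite (le_trans (fL _ _))//.
  rewrite (le_trans (ler_wpM2l L_ge0 (uv t)))// mulrCA -mulrA ler_wpM2l//.
  rewrite mulrA ler_wpM2r ?w_ge0// /la; nra.
(* Starting at [T 0] rather than 0 makes the affine part [a + b * (t - t0)] cancel in every
   difference of iterates. *)
pose Y n := iter n T (T (fun=> 0)).
have cY n : continuous (Y n).
  elim: n => [|n cYn].
    by apply: continuous_of_is_derive (dT _ _).2; exact: cst_continuous.
  exact: continuous_of_is_derive (dT _ cYn).2.
(* Two values of [f] differ by at most [2 * B], which bounds the first step since [la] and [w] are
   at least 1. *)
pose M := 2 * B.
have M_ge0 : 0 <= M by rewrite mulr_ge0.
have hn_ge0 n : 0 <= 2^-1 ^+ n :> R by rewrite exprn_ge0 ?invr_ge0.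
have dY n t : `|Y n.+1 t - Y n t| <= M * 2^-1 ^+ n * w t.
  elim: n t => [|n IHn] t; last first.
    rewrite exprSr mulrA; apply: (T_half (Y n.+1) (Y n)) IHn t => //.
    exact: mulr_ge0.
  rewrite expr0 mulr1; apply: (T_compare (Y 0%N) (fun=> 0) M (cY 0%N)) => //.
    exact: cst_continuous.
  move=> s; apply: (@le_trans _ _ (M * 1)).
    by rewrite mulr1 (le_trans (ler_normB _ _))// /M mulr_natl mulr2n lerD.
  rewrite ler_wpM2l// -[leLHS]mulr1 ler_pM// /la; nra.
(* This is the tail from [n] on of the geometric series bounding the steps. The intervals of radius
   [r n t] around [Y n t] are therefore nested, and the limit is the supremum of their left ends. *)
pose r n t := 2 * M * 2^-1 ^+ n * w t.
have r_ge0 n t : 0 <= r n t by rewrite !mulr_ge0// ltW.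
have rS n t : r n.+1 t = r n t - M * 2^-1 ^+ n * w t.
  by rewrite /r exprS; field.
have decU m n t : (m <= n)%N -> Y n t + r n t <= Y m t + r m t.
  elim: n => [|n IHn]; first by rewrite leqn0 => /eqP ->.
  rewrite leq_eqVlt => /predU1P[->//|/IHn]; apply: le_trans.
  by have := dY n t; rewrite ler_norml rS => /andP[_]; lra.
have incL m n t : (m <= n)%N -> Y m t - r m t <= Y n t - r n t.
  elim: n => [|n IHn]; first by rewrite leqn0 => /eqP ->.
  rewrite leq_eqVlt => /predU1P[->//|/IHn] /le_trans; apply.
  by have := dY n t; rewrite ler_norml rS => /andP[+ _]; lra.
have LU m n t : Y m t - r m t <= Y n t + r n t.
  have := incL _ _ t (leq_maxl m n); have := decU _ _ t (leq_maxr m n).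
  have := r_ge0 (maxn m n) t; lra.
pose y t := sup (range (fun n => Y n t - r n t)).
have yY n t : `|Y n t - y t| <= r n t.
  have ub_y m : ubound (range (fun n => Y n t - r n t)) (Y m t + r m t).
    by move=> _ [k _ <-].
  have le_y : Y n t - r n t <= y t.
    apply: ub_le_sup; first by exists (Y 0%N t + r 0%N t).
    by exists n.
  have y_le : y t <= Y n t + r n t.
    by apply: ge_sup => //; exists (Y 0%N t - r 0%N t), 0%N.
  by rewrite ler_norml; apply/andP; split; lra.
have cy : continuous y.
  move=> t; apply/cvgrPdist_lt => /= e e0.
  have [n n_e] := @exists_geometric_lt _ (2 * M * (w t + 1)) _ (divr_gt0 e0 (ltr0Sn _ 2)).
  (* The convergence is uniform only where the weight is bounded; near [t] it stays below
     [w t + 1]. *)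
  have r_lt s : w s < w t + 1 -> r n s < e / 3.
    move=> ws; apply: le_lt_trans n_e.
    rewrite /r mulrAC; apply: ler_wpM2r; rewrite ?ler_wpM2l ?mulr_ge0//.
    exact: ltW.
  near=> s.
  have rt : r n t < e / 3 by apply: r_lt; rewrite ltrDl.
  have rs : r n s < e / 3.
    apply: r_lt; rewrite -ltrBlDl (le_lt_trans (ler_norm _))// distrC.
    near: s; apply: cvgr_dist_lt => //.
    exact: (continuous_of_is_derive w_dw).
  have Yts : `|Y n t - Y n s| < e / 3.
    near: s; apply: cvgr_dist_lt; last by rewrite divr_gt0.
    exact: cY.
  have := yY n t; have := yY n s; move: Yts.
  rewrite !ltr_norml !ler_norml => /andP[? ?] /andP[? ?] /andP[? ?].
  by apply/andP; split; lra.
(* For every [n], both [y t] and [T y t] lie within [r n t / 2] of [Y n.+1 t], and [r n t] tends to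
   0. *)
have yT : y = T y.
  apply/funext => t; apply/eqP; rewrite -subr_eq0 -normr_le0.
  rewrite leNgt; apply/negP => yT_gt0.
  have [n] := exists_geometric_lt (2 * (2 * M) * w t) yT_gt0.
  apply/negP; rewrite -leNgt.
  have -> : 2 * (2 * M) * w t * 2^-1 ^+ n = r n t + r n t by rewrite /r; ring.
  have := yY n.+1 t; have := @T_half _ _ (2 * M * 2^-1 ^+ n) (cY n) cy _ (yY n) t.
  rewrite !mulr_ge0// => /(_ isT).
  have -> : 2 * M * 2^-1 ^+ n / 2 * w t = r n t / 2 by rewrite /r; field.
  rewrite rS -[Y n.+1 t]/(T (Y n) t).
  have -> : M * 2^-1 ^+ n * w t = r n t / 2 by rewrite /r; field.
  have := r_ge0 n t.
  rewrite !ler_norml => ? /andP[? ?] /andP[? ?]; apply/andP; split; lra.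
have [Ty0 dTy] := dT _ cy; have [Vy0 dVy] := dV _ cy.
by rewrite -yT in Ty0 dTy; exists y, (V y).
Unshelve. all: by end_near. Qed.

(** * The equations of motion in components *)

Lemma is_derive1P (R : realType) (V : normedModType R) (f : R -> V) (t : R)
    (df : V) :
  derivable f t 1 /\ f^`() t = df <-> is_derive t 1 f df.
Proof.
rewrite derive1E; split=> [[f_t fE]|fdf]; first exact: DeriveDef.
by split; [exact: ex_derive|exact: derive_val].
Qed.

Lemma is_derive_colP (R : realType) (n : nat) (u : R -> 'cV[R]_n) (t : R)
    (v : 'cV[R]_n) :
  is_derive t 1 u v <-> forall i, is_derive t 1 (fun s => u s i 0) (v i 0).
Proof.
split=> [uv i|uv].
  have u_t : derivable u t 1 by exact: ex_derive.
  have vE : 'D_1 u t = v by exact: derive_val.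
  apply: DeriveDef; first exact: (derivable_mxP _ _ _).1.
  by rewrite -vE derive_mx// mxE.
have u_t : derivable u t 1.
  apply/derivable_mxP => i j; rewrite ord1; have := uv i => ?.
  exact: ex_derive.
apply: DeriveDef => //; rewrite derive_mx//.
apply/colP => i; rewrite mxE; have := uv i => ?; exact: derive_val.
Qed.

Lemma forall_ord3 (P : 'I_3 -> Prop) :
  (forall i, P i) <-> [/\ P 0, P 1 & P 2].
Proof.
split=> [//|[P0 P1 P2] i].
case: i => [[|[|[|//]]]] lti.
- by have -> : Ordinal lti = 0 by exact: val_inj.
- by have -> : Ordinal lti = 1 by exact: val_inj.
- by have -> : Ordinal lti = 2 by exact: val_inj.
Qed.

Lemma vec3E (R : realType) (x y z : R) :
  (vec3 x y z 0 0 = x) * (vec3 x y z 1 0 = y) * (vec3 x y z 2 0 = z).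
Proof. by rewrite !mxE. Qed.

Lemma vec3_eqP (R : realType) (u v : 'cV[R]_3) :
  u = v <-> [/\ u 0 0 = v 0 0, u 1 0 = v 1 0 & u 2 0 = v 2 0].
Proof.
split=> [->//|uv]; apply/colP; exact: (forall_ord3 (fun i => u i 0 = v i 0)).2.
Qed.

Lemma sphere2E (R : realType) (u : 'cV[R]_3) :
  sphere2 u <-> u 0 0 ^+ 2 + u 1 0 ^+ 2 + u 2 0 ^+ 2 = 1.
Proof.
rewrite /sphere2/= !big_ord_recl big_ord0 addr0 addrA.
have -> : lift ord0 ord0 = 1 :> 'I_3 by exact: val_inj.
by have -> : lift ord0 (lift ord0 ord0) = 2 :> 'I_3 by exact: val_inj.
Qed.

(** The axial symmetry enters here: equal transverse moments and a center of mass on the axis remove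
    every torque from the third component of [omega]. *)
Lemma pendulum3D_solutionP (R : realType) (Jt Ja m g rhos : R) (I : set R)
    (Gamma omega : R -> 'cV[R]_3) :
  Jt != 0 -> Ja != 0 ->
  pendulum3D_solution (diag_mx (vec3 Jt Jt Ja)^T) m g (rhos *: vec3 0 0 1)
    I Gamma omega <->
  forall t, I t ->
    let G i := Gamma t i 0 in let w i := omega t i 0 in
    [/\ G 0 ^+ 2 + G 1 ^+ 2 + G 2 ^+ 2 = 1,
        [/\ is_derive t 1 (fun s => omega s 0 0)
              (((Jt - Ja) * w 1 * w 2 - m * g * rhos * G 1) / Jt),
            is_derive t 1 (fun s => omega s 1 0)
              (((Ja - Jt) * w 2 * w 0 + m * g * rhos * G 0) / Jt) &
            is_derive t 1 (fun s => omega s 2 0) 0] &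
        [/\ is_derive t 1 (fun s => Gamma s 0 0) (G 1 * w 2 - G 2 * w 1),
            is_derive t 1 (fun s => Gamma s 1 0) (G 2 * w 0 - G 0 * w 2) &
            is_derive t 1 (fun s => Gamma s 2 0) (G 0 * w 1 - G 1 * w 0)]].
Proof.
move=> Jt0 Ja0.
have JE (d : 'cV[R]_3) t : diag_mx (vec3 Jt Jt Ja)^T *m d
      = crossv (diag_mx (vec3 Jt Jt Ja)^T *m omega t) (omega t)
        + (m * g) *: crossv (rhos *: vec3 0 0 1) (Gamma t) <->
    d = vec3
      (((Jt - Ja) * omega t 1 0 * omega t 2 0 - m * g * rhos * Gamma t 1 0) / Jt)
      (((Ja - Jt) * omega t 2 0 * omega t 0 0 + m * g * rhos * Gamma t 0 0) / Jt)
      0.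
  rewrite !vec3_eqP !mul_diag_mx !mxE/=.
  split=> -[e0 e1 e2]; split.
  - by apply: (mulfI Jt0); rewrite e0; field.
  - by apply: (mulfI Jt0); rewrite e1; field.
  - by apply: (mulfI Ja0); rewrite e2; ring.
  - by rewrite e0; field.
  - by rewrite e1; field.
  - by rewrite e2; ring.
split=> sol t It.
- have [/sphere2E G1 dw /JE wE dG GE] := sol t It; split=> //.
  + have /is_derive_colP/forall_ord3 := (is_derive1P _ _ _).1 (conj dw wE).
    by rewrite !vec3E.
  + have /is_derive_colP/forall_ord3 := (is_derive1P _ _ _).1 (conj dG GE).
    by rewrite !vec3E.
- have [G1 dw dG] := sol t It.
  have /is_derive1P[? wE] : is_derive t 1 omega (vec3
      (((Jt - Ja) * omega t 1 0 * omega t 2 0 - m * g * rhos * Gamma t 1 0) / Jt)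
      (((Ja - Jt) * omega t 2 0 * omega t 0 0 + m * g * rhos * Gamma t 0 0) / Jt)
      0).
    by apply/is_derive_colP/forall_ord3; rewrite !vec3E.
  have /is_derive1P[? ?] : is_derive t 1 Gamma (crossv (Gamma t) (omega t)).
    by apply/is_derive_colP/forall_ord3; rewrite !vec3E.
  by split=> //; [exact/sphere2E|exact/JE].
Qed.

Lemma planar_pendulum_solutionP (R : realType) (Jt m g rhos : R) (I : set R)
    (theta omegay : R -> R) :
  Jt != 0 ->
  planar_pendulum_solution Jt m g rhos I theta omegay <->
  forall t, I t -> is_derive t 1 theta (omegay t) /\
    is_derive t 1 omegay (- (m * g * rhos / Jt * sin (theta t))).
Proof.
move=> Jt0; split=> sol t It.
- have [dw wE dth thE] := sol t It; split; apply/is_derive1P; split=> //.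
  by apply: (mulfI Jt0); rewrite wE; field.
- have [/is_derive1P[? ?] /is_derive1P[? wE]] := sol t It; split=> //.
  by rewrite wE; field.
Qed.

(** * The angle coordinate and its ambiguity *)

Lemma exists_angle (R : realType) (x z : R) :
  x ^+ 2 + z ^+ 2 = 1 -> exists theta, x = - sin theta /\ z = cos theta.
Proof.
move=> xz1.
have z1 : -1 <= z <= 1 by apply/andP; split; nra.
have zK : cos (acos z) = z by apply: acosK; rewrite in_itv.
have sin_z : sin (acos z) = `|x|.
  by rewrite sin_acos// -xz1 addrK sqrtr_sqr.
(* [acos] returns an angle with nonnegative sine, so the sign of [x] decides between [acos z] and
   its opposite. *)
have [x0|x0] := leP x 0.
- by exists (acos z); rewrite zK sin_z ler0_norm// opprK.
- by exists (- acos z); rewrite cosN zK sinN sin_z gtr0_norm// opprK.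
Qed.

Lemma periodicz (U V : zmodType) (f : U -> V) (T : U) :
  periodic f T -> forall (k : int) a, f (a + T *~ k) = f a.
Proof.
move=> fT [n|n] a; first exact: periodicn.
by rewrite NegzE mulrNz -[LHS](periodicn fT n.+1) subrK.
Qed.

(** Subtracting full turns leaves [r] in [0, 2 pi). There the half-angle formula forces
    [sin (r / 2)] to vanish, which happens only at [r = 0]. *)
Lemma cos_eq1 (R : realType) (x : R) :
  cos x = 1 -> exists k : int, x = k%:~R * (2 * pi).
Proof.
move=> cosx; have pi2_gt0 : 0 < 2 * pi :> R by rewrite mulr_gt0// pi_gt0.
pose k := Num.floor (x / (2 * pi)); exists k.
pose r := x - k%:~R * (2 * pi).
have xE : x = r + pi *+ 2 *~ k by rewrite /r -mulrzl mulr2n; ring.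
have r_ge0 : 0 <= r.
  by rewrite subr_ge0 -ler_pdivlMr// Num.Theory.floor_le.
have r_lt : r < 2 * pi.
  rewrite ltrBlDr -[X in X + _]mul1r -mulrDl -ltr_pdivrMr// addrC.
  by have := floorD1_gt (x / (2 * pi)); rewrite intrD.
have cosr : cos r = 1 by rewrite -cosx xE periodicz//; exact: cosD2pi.
suff r0 : r = 0 by apply/eqP; rewrite -subr_eq0 -/r r0.
apply/eqP; rewrite eq_le r_ge0 andbT leNgt; apply/negP => r_gt0.
have sin_gt0 : 0 < sin (r / 2).
  by apply: sin_gt0_pi; rewrite divr_gt0// ltr_pdivrMr// mulrC.
have := cos_mulr2n (r / 2).
have -> : r / 2 *+ 2 = r by rewrite -mulr_natr divfK.
rewrite cosr.
have := cos2Dsin2 (r / 2); nra.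
Qed.

Lemma planar_GammaE (R : realType) (theta : R) :
  (planar_Gamma theta 0 0 = - sin theta) * (planar_Gamma theta 1 0 = 0) *
  (planar_Gamma theta 2 0 = cos theta).
Proof. exact: vec3E. Qed.

Lemma planar_omegaE (R : realType) (omegay : R) :
  (planar_omega omegay 0 0 = 0) * (planar_omega omegay 1 0 = omegay) *
  (planar_omega omegay 2 0 = 0).
Proof. exact: vec3E. Qed.

Lemma planar_set_coordinates (R : realType) :
  planar_set R =
    [set x | exists theta omegay : R,
       x = (planar_Gamma theta, planar_omega omegay)].
Proof.
apply/seteqP; split=> [[G w] [/= /sphere2E G1 w0 w2 Gy]|_ [theta [omegay ->]]].
- have [theta [Gx Gz]] : exists theta, G 0 0 = - sin theta /\ G 2 0 = cos theta.
    by apply: exists_angle; rewrite -G1 Gy; ring.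
  exists theta, (w 1 0); congr pair.
    by apply/vec3_eqP; rewrite !planar_GammaE.
  by apply/vec3_eqP; rewrite !planar_omegaE.
- split; rewrite /= ?planar_GammaE ?planar_omegaE//.
  by apply/sphere2E; rewrite !planar_GammaE -(cos2Dsin2 theta); ring.
Qed.

Lemma planar_coordinates_eqP (R : realType)
    (theta omegay theta' omegay' : R) :
  (planar_Gamma theta, planar_omega omegay)
    = (planar_Gamma theta', planar_omega omegay') <->
  (exists k : int, theta' = theta + k%:~R * (2 * pi)) /\ omegay' = omegay.
Proof.
split=> [[/vec3_eqP + /vec3_eqP]|[[k ->] ->]].
- rewrite !planar_GammaE !planar_omegaE => -[/oppr_inj sinE _ cosE] [_ -> _].
  split=> //; have [k kE] : exists k : int, theta' - theta = k%:~R * (2 * pi).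
    by apply: cos_eq1; rewrite cosB -sinE -cosE -(cos2Dsin2 theta); ring.
  by exists k; rewrite -kE addrC subrK.
- congr pair; apply/vec3_eqP; rewrite !planar_GammaE.
  have -> : k%:~R * (2 * pi) = pi *+ 2 *~ k :> R.
    by rewrite -mulrzl mulr2n; ring.
  rewrite (periodicz (@sinD2pi R)) (periodicz (@cosD2pi R)); by [].
Qed.

(** * Invariance of the planar set *)

Lemma planar_set_invariant (R : realType) (Jt Ja m g rhos : R) (I : set R)
    (Gamma omega : R -> 'cV[R]_3) (t0 : R) :
  Jt != 0 -> Ja != 0 -> open_interval I ->
  pendulum3D_solution (diag_mx (vec3 Jt Jt Ja)^T) m g (rhos *: vec3 0 0 1)
    I Gamma omega ->
  I t0 -> planar_set R (Gamma t0, omega t0) ->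
  forall t, I t -> planar_set R (Gamma t, omega t).
Proof.
move=> Jt0 Ja0 [_ itvI] /(pendulum3D_solutionP _ _ _ _ _ _ Jt0 Ja0) sol It0.
move=> [/= _ w0t0 w2t0 G1t0].
have w2 t : I t -> omega t 2 0 = 0.
  move=> It; apply/eqP; rewrite -sqrf_eq0; apply/eqP.
  apply: (@gronwall_eq0 _ I (fun t => omega t 2 0 ^+ 2) (fun=> 0) 0 t0) => //.
  - move=> s /sol[_ [_ _ ?] _]; apply: is_derive_eq.
    by rewrite scaler0 addr0.
  - by move=> s _; exact: sqr_ge0.
  - by move=> s _; rewrite normr0 mul0r.
  - by rewrite w2t0 expr0n.
pose c := m * g * rhos / Jt.
(* The constant [1 + |c|] comes from [|Gamma_z| <= 1] on the sphere and from
   [2 * |x * y| <= x ^+ 2 + y ^+ 2]. *)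
have E0 t : I t -> omega t 0 0 ^+ 2 + Gamma t 1 0 ^+ 2 = 0.
  apply: (@gronwall_eq0 _ I (fun t => omega t 0 0 ^+ 2 + Gamma t 1 0 ^+ 2)
    (fun t => 2 * (Gamma t 2 0 - c) * (omega t 0 0 * Gamma t 1 0))
    (1 + `|c|) t0) => //.
  - move=> s Is; have [_ [? _ _] [_ ? _]] := sol s Is; apply: is_derive_eq.
    by rewrite w2// /GRing.scale/= /c; field.
  - by move=> s _; rewrite addr_ge0// sqr_ge0.
  - move=> s /sol[G1 _ _] /=; set x := omega s 0 0; set y := Gamma s 1 0.
    have -> : 2 * (Gamma s 2 0 - c) * (x * y) =
      (Gamma s 2 0 - c) * (2 * (x * y)) by ring.
    rewrite normrM ler_pM//.
      rewrite (le_trans (ler_normB _ _))// lerD2r ler_norml.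
      have := sqr_ge0 (Gamma s 0 0); have := sqr_ge0 (Gamma s 1 0).
      by move=> ? ?; apply/andP; split; nra.
    have := sqr_ge0 (x - y); have := sqr_ge0 (x + y).
    by rewrite ler_norml => ? ?; apply/andP; split; nra.
  - by rewrite w0t0 G1t0 expr0n addr0.
move=> t It; have /eqP := E0 t It.
rewrite paddr_eq0 ?sqr_ge0// !sqrf_eq0 => /andP[/eqP w0 /eqP G1].
split=> //=; last exact: w2.
by have [/sphere2E] := sol t It.
Qed.

(** * Uniqueness and global existence for the planar pendulum *)

Lemma sin_lipschitz (R : realType) (x y : R) : `|sin x - sin y| <= `|x - y|.
Proof.
wlog xy : x y / y <= x => [h|].
  by have [/h//|/ltW/h] := leP y x; rewrite distrC (distrC y).
rewrite [leRHS]ger0_norm ?subr_ge0// ler_norml; apply/andP; split.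
- suff : y + sin y <= x + sin x by lra.
  by apply: (@ge0_is_derive_nondecreasing _ setT (fun t => t + sin t)
    (fun t => 1 + cos t)).
- suff : y - sin y <= x - sin x by lra.
  by apply: (@ge0_is_derive_nondecreasing _ setT (fun t => t - sin t)
    (fun t => 1 - cos t)).
Qed.

Lemma planar_motion_unique (R : realType) (Jt m g rhos t0 : R) (I : set R)
    (theta omegay theta' omegay' : R -> R) :
  Jt != 0 -> open_interval I -> I t0 ->
  planar_pendulum_solution Jt m g rhos I theta omegay ->
  planar_pendulum_solution Jt m g rhos I theta' omegay' ->
  theta' t0 = theta t0 -> omegay' t0 = omegay t0 ->
  forall t, I t -> theta' t = theta t /\ omegay' t = omegay t.
Proof.
move=> Jt0 [_ itvI] It0 /(planar_pendulum_solutionP _ _ _ _ _ _ Jt0) sol.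
move=> /(planar_pendulum_solutionP _ _ _ _ _ _ Jt0) sol' th0 w0 t It.
pose c := m * g * rhos / Jt.
(* Gronwall for the squared distance of the two motions; the Lipschitz bound on the sine again
   yields the constant [1 + |c|]. *)
have : (theta' t - theta t) ^+ 2 + (omegay' t - omegay t) ^+ 2 = 0.
  move: t It; apply: (@gronwall_eq0 _ I
    (fun t => (theta' t - theta t) ^+ 2 + (omegay' t - omegay t) ^+ 2)
    (fun t => 2 * (omegay' t - omegay t) *
      ((theta' t - theta t) - c * (sin (theta' t) - sin (theta t))))
    (1 + `|c|) t0) => //.
  - move=> s Is; have [? ?] := sol s Is; have [? ?] := sol' s Is.
    by apply: is_derive_eq; rewrite /GRing.scale/= /c; field.
  - by move=> s _; rewrite addr_ge0// sqr_ge0.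
  - move=> s _ /=; have := sin_lipschitz (theta' s) (theta s).
    set x := theta' s - theta s; set y := omegay' s - omegay s.
    set d := sin _ - _ => dx.
    have xd : `|x - c * d| <= (1 + `|c|) * `|x|.
      rewrite (le_trans (ler_normB _ _))// mulrDl mul1r lerD2l normrM.
      by rewrite ler_wpM2l.
    rewrite normrM normrM ger0_norm// (le_trans (ler_wpM2l _ xd))// mulrCA.
    rewrite ler_wpM2l ?addr_ge0//.
    rewrite -(real_normK (num_real x)) -(real_normK (num_real y)).
    have := sqr_ge0 (`|x| - `|y|); nra.
  - by rewrite th0 w0 !subrr expr0n addr0.
move=> /eqP; rewrite paddr_eq0 ?sqr_ge0// !sqrf_eq0 !subr_eq0.
by move=> /andP[/eqP ? /eqP ?].
Qed.

(** The pendulum is the second-order equation with right-hand side [- (c * sin x)], for which [|c|]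
    is both a Lipschitz constant and a bound. *)
Lemma planar_flow (R : realType) (Jt m g rhos t0 theta0 omegay0 : R) :
  Jt != 0 ->
  exists theta omegay : R -> R,
    [/\ planar_pendulum_solution Jt m g rhos setT theta omegay,
        theta t0 = theta0 & omegay t0 = omegay0].
Proof.
move=> Jt0; pose c := m * g * rhos / Jt.
have fL x y : `|- (c * sin x) - - (c * sin y)| <= `|c| * `|x - y|.
  by rewrite -opprD normrN -mulrBr normrM ler_wpM2l// sin_lipschitz.
have fB x : `|- (c * sin x)| <= `|c|.
  by rewrite normrN normrM ler_piMr// sin_max.
have [theta [omegay [th0 w0 dth dw]]] :=
  exists_second_order_solution t0 theta0 omegay0 fL fB.
exists theta, omegay; split=> //.
by apply/planar_pendulum_solutionP.
Qed.

(** * Lifting planar motions and reducing the dynamics *)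

Lemma planar_motion_lift (R : realType) (Jt Ja m g rhos : R) (I : set R)
    (Gamma omega : R -> 'cV[R]_3) :
  Jt != 0 -> Ja != 0 -> open_interval I ->
  pendulum3D_solution (diag_mx (vec3 Jt Jt Ja)^T) m g (rhos *: vec3 0 0 1)
    I Gamma omega ->
  (forall t, I t -> planar_set R (Gamma t, omega t)) ->
  exists theta omegay : R -> R,
    (forall t, I t -> {for t, continuous theta}) /\
    (forall t, I t -> Gamma t = planar_Gamma (theta t) /\
                      omega t = planar_omega (omegay t)).
Proof.
move=> Jt0 Ja0 [_ itvI] /(pendulum3D_solutionP _ _ _ _ _ _ Jt0 Ja0) sol plan.
have [[t0 It0]|I0] := pselect (exists t, I t); last first.
  by exists (fun=> 0), (fun=> 0); split=> t It; case: I0; exists t.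
have : planar_set R (Gamma t0, omega t0) by exact: plan.
rewrite planar_set_coordinates => -[theta0 [omegay0 [Gt0 wt0]]].
have [theta [omegay [psol th0 w0]]] :=
  planar_flow m g rhos t0 theta0 omegay0 Jt0.
move/(planar_pendulum_solutionP _ _ _ _ _ _ Jt0) in psol.
have dth t := (psol t Logic.I).1; have dw t := (psol t Logic.I).2.
pose c := m * g * rhos / Jt.
(* Squared distance between the motion and the image of the flow line, the remaining components
   being zero on both sides. In its derivative the terms carrying the angular velocity itself
   cancel, which leaves a Gronwall constant depending on [c] alone. *)
pose E t := (Gamma t 0 0 + sin (theta t)) ^+ 2
  + (Gamma t 2 0 - cos (theta t)) ^+ 2 + (omega t 1 0 - omegay t) ^+ 2.
have E0 t : I t -> E t = 0.
  apply: (@gronwall_eq0 _ I E (fun t => 2 * (omega t 1 0 - omegay t) *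
      ((c - cos (theta t)) * (Gamma t 0 0 + sin (theta t))
       - sin (theta t) * (Gamma t 2 0 - cos (theta t))))
    (2 + `|c|) t0) => //.
  - move=> s Is; have [_ [_ ? _] [? _ ?]] := sol s Is.
    have [/= _ w0s w2s G1s] := plan s Is; have := dth s => ?; have := dw s => ?.
    have ? : is_derive s 1 (fun t => sin (theta t))
      (cos (theta s) * omegay s) by exact: is_derive1_comp.
    have ? : is_derive s 1 (fun t => cos (theta t))
      (- sin (theta s) * omegay s) by exact: is_derive1_comp.
    rewrite /E; apply: is_derive_eq.
    by rewrite w0s w2s G1s /GRing.scale/= /c; field.
  - by move=> s _; rewrite !addr_ge0// sqr_ge0.
  - move=> s _; rewrite /E /=.
    set x := _ + sin _; set z := Gamma s 2 0 - _; set y := _ - omegay s.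
    have h1 : `|(c - cos (theta s)) * x - sin (theta s) * z|
        <= (`|c| + 1) * `|x| + `|z|.
      rewrite (le_trans (ler_normB _ _))// lerD// normrM.
        by rewrite ler_wpM2r// (le_trans (ler_normB _ _))// lerD2l cos_max.
      by rewrite ler_piMl// sin_max.
    rewrite normrM normrM ger0_norm//.
    rewrite (le_trans (ler_wpM2l _ h1)) ?mulr_ge0//.
    rewrite -(real_normK (num_real x)) -(real_normK (num_real y)).
    rewrite -(real_normK (num_real z)).
    have := normr_ge0 c; have := sqr_ge0 (`|x| - `|y|).
    have := sqr_ge0 (`|z| - `|y|); have := sqr_ge0 `|z|.
    have := sqr_ge0 `|x|; nra.
  - rewrite /E Gt0 wt0 !planar_GammaE !planar_omegaE th0 w0.
    by rewrite addNr !subrr expr0n !addr0.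
exists theta, omegay; split=> [t _|t It].
  exact: (continuous_of_is_derive dth).
have [/= _ w0t w2t G1t] := plan t It.
have /eqP := E0 t It; rewrite !paddr_eq0 ?addr_ge0 ?sqr_ge0// !sqrf_eq0.
move=> /andP[/andP[/eqP Gx /eqP Gz] /eqP wy]; split; apply/vec3_eqP.
  by rewrite !planar_GammaE; split=> //; lra.
by rewrite !planar_omegaE; split=> //; lra.
Qed.

(** Recovers differentiability of a merely continuous angle. The sine of [theta s - theta t] is a
    fixed linear combination of the differentiable functions [sin (theta s)] and [cos (theta s)],
    and continuity keeps the difference on the branch inverted by [asin]. *)
Lemma is_derive_angle (R : realType) (theta : R -> R) (w t : R) :
  {for t, continuous theta} ->
  is_derive t 1 (fun s => sin (theta s)) (cos (theta t) * w) ->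
  is_derive t 1 (fun s => cos (theta s)) (- sin (theta t) * w) ->
  is_derive t 1 theta w.
Proof.
move=> cth dsin dcos.
pose d s := sin (theta s) * cos (theta t) - cos (theta s) * sin (theta t).
have dE s : d s = sin (theta s - theta t) by rewrite sinB.
have dt0 : d t = 0 by rewrite dE subrr sin0.
have dd : is_derive t 1 d w.
  rewrite /d; apply: is_derive_eq; rewrite /GRing.scale/=.
  by rewrite -[RHS]mul1r -(cos2Dsin2 (theta t)); ring.
have dasin : is_derive t 1 (@asin R \o d) w.
  rewrite -[w]mul1r; apply: is_derive1_comp; rewrite dt0.
  have := @is_derive1_asin R 0; rewrite expr0n subr0 sqrtr1 invr1; apply.
  by rewrite ltrN10 ltr01.
have dth : is_derive t 1 (fun s => asin (d s) + theta t) w.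
  by apply: is_derive_eq; rewrite addr0.
apply: near_eq_is_derive dth; near=> s.
rewrite dE sinK ?subrK// in_itv/= -ler_norml ltW//.
near: s; apply: cvgr_distC_lt => //.
by rewrite divr_gt0// pi_gt0.
Unshelve. all: by end_near. Qed.

Lemma planar_reduction (R : realType) (Jt Ja m g rhos : R) (I : set R)
    (theta omegay : R -> R) :
  Jt != 0 -> Ja != 0 -> (forall t, I t -> {for t, continuous theta}) ->
  pendulum3D_solution (diag_mx (vec3 Jt Jt Ja)^T) m g (rhos *: vec3 0 0 1) I
    (fun t => planar_Gamma (theta t)) (fun t => planar_omega (omegay t)) <->
  planar_pendulum_solution Jt m g rhos I theta omegay.
Proof.
move=> Jt0 Ja0 cth; rewrite pendulum3D_solutionP// planar_pendulum_solutionP//.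
have GE : ((fun s => planar_Gamma (theta s) 0 0) = fun s => - sin (theta s)) *
    ((fun s => planar_Gamma (theta s) 1 0) = fun=> 0) *
    ((fun s => planar_Gamma (theta s) 2 0) = fun s => cos (theta s)).
  by split; [split|]; apply/funext => s; rewrite planar_GammaE.
have wE : ((fun s => planar_omega (omegay s) 0 0) = fun=> 0) *
    ((fun s => planar_omega (omegay s) 1 0) = omegay) *
    ((fun s => planar_omega (omegay s) 2 0) = fun=> 0).
  by split; [split|]; apply/funext => s; rewrite planar_omegaE.
split=> sol t It; move: (sol t It); rewrite /= !GE !wE !planar_GammaE !planar_omegaE.
(* From the body to the angle, [theta] is only known to be continuous, so its derivative is read off
   from those of its sine and cosine. The converse below is the chain rule. *)
- move=> [_ [_ dw _] [dNsin _ dcos]]; split.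
    apply: is_derive_angle; first exact: cth.
      have -> : (fun s => sin (theta s)) = (fun s => - - sin (theta s)).
        by apply/funext => s; rewrite opprK.
      by apply: is_derive_eq; ring.
    by move: dcos; rewrite mul0r subr0.
  by apply: is_derive_eq; field.
- move=> [dth dw].
  have ? : is_derive t 1 (fun s => sin (theta s))
    (cos (theta t) * omegay t) by exact: is_derive1_comp.
  have ? : is_derive t 1 (fun s => cos (theta s))
    (- sin (theta t) * omegay t) by exact: is_derive1_comp.
  split.
  + by rewrite -(cos2Dsin2 (theta t)); ring.
  + split; [|apply: is_derive_eq; field => //|].
      by rewrite !(mulr0, subr0, mul0r); exact: is_derive_cst.
    exact: is_derive_cst.
  + split; [apply: is_derive_eq; ring| |apply: is_derive_eq; ring].
    by rewrite !(mulr0, subr0); exact: is_derive_cst.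
Qed.

Theorem proposition7 (R : realType) (Jt Ja m g rhos : R)
    (J : 'M[R]_3) (rho : 'cV[R]_3)
    (Jt_gt0 : 0 < Jt) (Ja_gt0 : 0 < Ja) (m_gt0 : 0 < m) (g_gt0 : 0 < g)
    (rhos_gt0 : 0 < rhos)
    (HJ : J = diag_mx (vec3 Jt Jt Ja)^T)
    (Hrho : rho = rhos *: vec3 0 0 1) :
  (* (theta, omega_y), theta modulo 2 pi, are coordinates on the planar set *)
  (planar_set R =
     [set x | exists theta omegay : R,
        x = (planar_Gamma theta, planar_omega omegay)] /\
   (forall theta omegay theta' omegay' : R,
      (planar_Gamma theta, planar_omega omegay)
        = (planar_Gamma theta', planar_omega omegay') <->
      (exists k : int, theta' = theta + k%:~R * (2 * pi)) /\
      omegay' = omegay)) /\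
  (* the planar set is invariant under the 3D pendulum *)
  (forall (I : set R) (Gamma omega : R -> 'cV[R]_3) (t0 : R),
     open_interval I -> pendulum3D_solution J m g rho I Gamma omega ->
     I t0 -> planar_set R (Gamma t0, omega t0) ->
     forall t, I t -> planar_set R (Gamma t, omega t)) /\
  (* motions in the planar set lift to continuous coordinate curves, and in
     coordinates the restricted dynamics are those of the planar pendulum *)
  ((forall (I : set R) (Gamma omega : R -> 'cV[R]_3),
      open_interval I -> pendulum3D_solution J m g rho I Gamma omega ->
      (forall t, I t -> planar_set R (Gamma t, omega t)) ->
      exists theta omegay : R -> R,
        (forall t, I t -> {for t, continuous theta}) /\
        (forall t, I t -> Gamma t = planar_Gamma (theta t) /\
                          omega t = planar_omega (omegay t))) /\
   (forall (I : set R) (theta omegay : R -> R),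
      open_interval I -> (forall t, I t -> {for t, continuous theta}) ->
      (pendulum3D_solution J m g rho I
         (fun t => planar_Gamma (theta t)) (fun t => planar_omega (omegay t))
       <-> planar_pendulum_solution Jt m g rhos I theta omegay))) /\
  (* the planar dynamics define a flow: through every initial condition there
     is a motion defined for all times, and it is unique *)
  (forall t0 theta0 omegay0 : R,
     exists theta omegay : R -> R,
       [/\ planar_pendulum_solution Jt m g rhos setT theta omegay,
           theta t0 = theta0, omegay t0 = omegay0 &
           forall (I : set R) (theta' omegay' : R -> R),
             open_interval I -> I t0 ->
             planar_pendulum_solution Jt m g rhos I theta' omegay' ->
             theta' t0 = theta0 -> omegay' t0 = omegay0 ->
             forall t, I t -> theta' t = theta t /\ omegay' t = omegay t]).
Proof.
have Jt0 : Jt != 0 by exact: lt0r_neq0.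
have Ja0 : Ja != 0 by exact: lt0r_neq0.
subst J rho; split; [|split; [|split]].
- split; first exact: planar_set_coordinates.
  exact: planar_coordinates_eqP.
- by move=> I Gamma omega t0 oI sol It0; exact: planar_set_invariant oI sol It0.
- split; first by move=> I Gamma omega; exact: planar_motion_lift.
  by move=> I theta omegay _; exact: planar_reduction.
- move=> t0 theta0 omegay0.
  have [theta [omegay [sol th0 w0]]] :=
    planar_flow m g rhos t0 theta0 omegay0 Jt0.
  exists theta, omegay; split=> // I theta' omegay' oI It0 sol' th0' w0'.
  apply: (planar_motion_unique Jt0 oI It0 _ sol').
  + by move=> t _; exact: sol.
  + by rewrite th0'.
  + by rewrite w0'.
Qed.
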